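(* Let $X$ be a finite-dimensional real Hilbert space, let $A:X\rightrightarrows X$ and $B:X\rightrightarrows X$ be maximally monotone, and set $D:=\operatorname{dom}A-\operatorname{dom}B$ and $R:=\operatorname{ran}A+\operatorname{ran}B$. Suppose that one of the following holds: (i) for every $w\in \operatorname{ri}D\cap\operatorname{ri}R$, $\operatorname{ri}(\operatorname{ran}A+\operatorname{ran}B)\subseteq \operatorname{ri}\operatorname{ran}(A+B_w)$, where $B_w:x\mapsto B(x-w)$; (ii) $A$ and $B$ are $3^*$ monotone; (iii) $\operatorname{dom}B+(\operatorname{ri}D\cap\operatorname{ri}R)\subseteq\operatorname{dom}A$ and $A$ is $3^*$ monotone; (iv) there exists $C\in\{A,B\}$ such that $\operatorname{dom}C=X$ and $C$ is $3^*$ monotone. Then $\overline{\operatorname{ran}(\mathrm{Id}-T_{(A,B)})}=\overline{D\cap R}=\overline{D}\cap\overline{R}$ and $v_{(A,B)}=P_{\overline{D}\cap\overline{R}}(0)$.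
   Context: For a maximally monotone operator $A$ on $X$, the resolvent is $J_A=(\mathrm{Id}+A)^{-1}$ (single-valued with full domain) and the reflected resolvent is $R_A=2J_A-\mathrm{Id}$. The Douglas--Rachford operator of the ordered pair $(A,B)$ is $T_{(A,B)}:=\tfrac12\mathrm{Id}+\tfrac12R_BR_A=\mathrm{Id}-J_A+J_BR_A$. $P_C$ is the projector onto a nonempty closed convex set $C$. The infimal displacement vector is $v_{(A,B)}:=P_{\overline{\operatorname{ran}(\mathrm{Id}-T_{(A,B)})}}(0)$ (the closure of the range is convex). A monotone operator $A:X\rightrightarrows X$ is $3^*$ monotone (rectangular) if for all $x\in\operatorname{dom}A$ and $v\in\operatorname{ran}A$, $\inf_{(z,w)\in\operatorname{gra}A}\langle x-z,v-w\rangle>-\infty$. For $S\subseteq X$, $\operatorname{ri}S$ is the interior of $S$ relative to its affine hull. Sums and differences of sets are Minkowski sums and differences. *)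

(* Defs.v *)
From HB Require Import structures.
From mathcomp Require Import all_boot all_order all_algebra.
From mathcomp Require Import all_classical all_reals all_analysis.

Set Implicit Arguments.
Unset Strict Implicit.
Unset Printing Implicit Defensive.

Import Order.TTheory GRing.Theory Num.Theory.
Import numFieldNormedType.Exports.

Local Open Scope classical_set_scope.
Local Open Scope ring_scope.

Section Sets.
Context {R : realType} {X : normedModType R}.
Implicit Types (S T : set X).

Definition set_add S T : set X := [set x + y | x in S & y in T].

Definition set_sub S T : set X := [set x - y | x in S & y in T].

Definition affine_set S : Prop :=
  forall x y (t : R), S x -> S y -> S ((1 - t) *: x + t *: y).

Definition affine_hull S : set X := smallest affine_set S.

(* The carrier of [subspace (affine_hull S)] is all of X, with the points
   outside the affine hull isolated; as S lies in its affine hull, these points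
   do not contribute to the interior of S. *)
Definition ri S : set X := @interior (subspace (affine_hull S)) S.

(* The default value 0 is only used when x has no nearest point in S. *)
Definition projector S (x : X) : X :=
  xget 0 [set p | S p /\ forall c, S c -> `|x - p| <= `|x - c|].

End Sets.

Section Operators.
Context {R : realType} {X : normedModType R}.
Implicit Types (A B : X -> set X).

Definition gra A : set (X * X) := [set p | A p.1 p.2].

Definition dom A : set X := [set x | A x !=set0].

Definition ran A : set X := \bigcup_x A x.

Definition op_id : X -> set X := fun x => [set x].

Definition op_add A B : X -> set X := fun x => set_add (A x) (B x).

Definition op_inv A : X -> set X := fun u => [set x | A x u].

Definition op_shift A (w : X) : X -> set X := fun x => A (x - w).

(* (Id + A)^-1 is single-valued with full domain when A is maximally monotone;
   the default value 0 is never used in that case. *)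
Definition resolvent A (x : X) : X := xget 0 (op_inv (op_add op_id A) x).

Definition reflected_resolvent A (x : X) : X := 2 *: resolvent A x - x.

Definition douglas_rachford A B (x : X) : X :=
  2^-1 *: x + 2^-1 *: reflected_resolvent B (reflected_resolvent A x).

Definition displacement_range A B : set X :=
  range (fun x => x - douglas_rachford A B x).

Definition infimal_displacement A B : X :=
  projector (closure (displacement_range A B)) 0.

End Operators.

Section Monotone.
Context {R : realType} {X : normedModType R} (dot : {dot X for @idfun R}).
Implicit Types (A B : X -> set X).

Definition monotone_op A : Prop :=
  forall x y u v, A x u -> A y v -> 0 <= dot (x - y) (u - v).

Definition maximally_monotone A : Prop :=
  monotone_op A /\
  forall B, monotone_op B -> gra A `<=` gra B -> gra B `<=` gra A.

Definition star3_monotone A : Prop :=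
  monotone_op A /\
  forall x v, dom A x -> ran A v ->
    (-oo < ereal_inf [set (dot (x - p.1) (v - p.2))%:E | p in gra A])%E.

End Monotone.

(* Main.v *)
Require Import Defs.
From HB Require Import structures.
From mathcomp Require Import all_boot all_order all_algebra.
From mathcomp Require Import all_classical all_reals all_analysis.
From mathcomp Require Import ring lra.

Set Implicit Arguments.
Unset Strict Implicit.
Unset Printing Implicit Defensive.

Import Order.TTheory GRing.Theory Num.Theory.
Import numFieldNormedType.Exports.

Local Open Scope classical_set_scope.
Local Open Scope ring_scope.

(** Write a point of the displacement range as w = x - T x. With a = J_A x and
    b = J_B (R_A x) this says exactly that w = a - b = u + v for some u in A a
    and v in B b [displacement_rangeP]. So the range lies in D and in S, and
    the content is that every common point of cl D and cl S is a limit of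
    displacements. This splits into two independent facts.

    Analytic part. Let w = a1 - b1 = u1 + v1, and suppose that
    <a - a1, u - u1> is bounded below on the graph of A and <b - b1, v - v1> on
    the graph of B. As Id - T is monotone and continuous, e x + (Id - T) x = w
    has a solution x for each e in (0, 1]. Write x - T x through a, b, u, v and
    add the two lower bounds: the terms in a cancel and what is left is a
    bound of e |x|^2 that does not depend on e. So e x tends to 0 with e, and w
    is a limit of displacements [closure_displacement_of_bounds]. Rectangularity
    gives such a lower bound for arbitrary a1 in dom A and u1 in ran A;
    monotonicity alone gives it when (a1, u1) is in the graph. Hypotheses
    (ii), (iii) and (iv) each allow a choice of a1, b1, u1, v1 in which one of
    these applies to A and one to B; under (i) the point w is itself a
    displacement.

    Geometric part. The domain and the range of a maximally monotone operator
    are nearly convex, that is, they contain the relative interior of a convex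
    set that contains them [nearly_convex_dom, nearly_convex_ran], and so are
    D and S [nearly_convex_comb]. By Minty's theorem [minty],
    dom A + ran A = X = dom B + ran B, which reads D - S = X. Two nearly convex
    sets whose difference is X have relative interiors that meet, and a common
    closure point moved slightly towards a point of both relative interiors
    enters both [closure_ri_meet]. So it suffices to approximate the points w
    that are in ri D and in ri S, where the hypotheses apply.

    Finite dimension enters through the existence of cluster points of bounded
    sequences [bounded_cluster] and of relative interior points
    [rint_nonempty]. *)

(** * Compactness in finite dimension *)
Section FiniteDimension.
Context {R : realType} {X : normedModType R} {n : nat}.
Hypothesis hfin : Vector.axiom n X.

Lemma linear_rV_bounded (Y : normedModType R) (g : 'rV[R]_n -> Y) :
  linear g -> exists2 K : R, 0 <= K & forall c, `|g c| <= K * `|c|.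
Proof.
move=> glin; pose G : {linear 'rV[R]_n -> Y} :=
  HB.pack g (GRing.isLinear.Build _ _ _ _ g glin).
exists (\sum_(i < n) `|g 'e_i|) => [|c]; first exact: sumr_ge0.
rewrite -[g c]/(G c) {1}[c]row_sum_delta linear_sum.
rewrite (le_trans (ler_norm_sum _ _ _))// mulr_suml ler_sum// => i _.
rewrite linearZ normrZ mulrC ler_wpM2l// [leRHS]mx_normrE.
by apply/bigmax_geP; right => /=; exists (0, i).
Qed.

Lemma linear_rV_continuous (g : {linear 'rV[R]_n -> X}) : continuous g.
Proof.
have [L L0 gL] := linear_rV_bounded (linearP g).
move=> c; apply/(@cvgrPdist_lt _ _ _ _ (nbhs_filter c)) => e e0.
apply/nbhs_ballP; exists (e / (L + 1)).
  by rewrite /= divr_gt0 ?ltr_wpDl.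
move=> d; rewrite -ball_normE/= ltr_pdivlMr ?ltr_wpDl// => cd.
rewrite -linearB (le_lt_trans (gL _))//; apply: le_lt_trans cd.
by rewrite mulrC ler_wpM2l// lerDl.
Qed.

(** The inverse of a coordinate map is continuous, so its norm has a positive
    minimum on the compact unit sphere of coordinates; the inverse of that
    minimum bounds the coordinates of a vector by its norm. *)
Lemma bounded_coordinates : exists (f : {linear X -> 'rV[R]_n})
    (g : {linear 'rV[R]_n -> X}) (K : R),
  [/\ 0 < K, cancel f g, cancel g f & forall x, `|f x| <= K * `|x|].
Proof.
case: hfin => f0 flin [g0 f0K g0K].
have [f fE] : exists f : {linear X -> 'rV[R]_n}, f =1 f0.
  pose F : {linear X -> 'rV[R]_n} :=
    HB.pack f0 (GRing.isLinear.Build _ _ _ _ f0 flin).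
  by exists F.
have glin : linear g0.
  by move=> a u v; apply: (can_inj f0K); rewrite flin !g0K.
have [g gE] : exists g : {linear 'rV[R]_n -> X}, g =1 g0.
  pose G : {linear 'rV[R]_n -> X} :=
    HB.pack g0 (GRing.isLinear.Build _ _ _ _ g0 glin).
  by exists G.
have fK : cancel f g by move=> x; rewrite fE gE f0K.
have gK : cancel g f by move=> x; rewrite fE gE g0K.
have gcont : continuous (fun c => `|g c|).
  move=> c; apply: continuous_comp; first exact: linear_rV_continuous.
  exact: norm_continuous.
pose S : set 'rV[R]_n := [set c | `|c| = 1].
have cS : compact S.
  apply: bounded_closed_compact.
    by exists 1; split => // r r1 c /= ->; exact: ltW.
  have -> : S = (fun c => `|c|) @^-1` [set 1] by [].
  by apply: closed_comp => [c _|]; [exact: norm_continuous|exact: closed_eq].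
(* The unit sphere is empty exactly when the dimension is 0. *)
have [S0|/set0P S0] := eqVneq S set0.
  exists f, g, 1; split => // x; rewrite mul1r.
  suff -> : f x = 0 by rewrite normr0.
  apply/eqP/negP => /negP x0.
  suff : S (`|f x|^-1 *: f x) by rewrite S0.
  by rewrite /S/= normrZ normfV normr_id mulVf// normr_eq0.
have [c0 + c0min] := compact_EVT_min S0 cS (continuous_subspaceT gcont).
rewrite inE /S /= => c01.
have m0 : 0 < `|g c0|.
  rewrite normr_gt0; apply/eqP => /(congr1 f); rewrite gK => c00.
  by move: c01; rewrite c00 (linear0 f) normr0 => /esym/eqP; rewrite oner_eq0.
exists f, g, `|g c0|^-1; split => //; first by rewrite invr_gt0.
move=> x; have [->|x0] := eqVneq (f x) 0.
  by rewrite normr0 mulr_ge0.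
rewrite ler_pdivlMl// -ler_pdivlMr ?normr_gt0//.
have := c0min (`|f x|^-1 *: f x); rewrite inE /S/= normrZ normfV normr_id.
rewrite mulVf ?normr_eq0// => /(_ erefl) /le_trans; apply.
by rewrite linearZ/= fK normrZ normfV normr_id mulrC.
Unshelve. all: by end_near. Qed.

(** The Bolzano-Weierstrass theorem, transported from row vectors along bounded
    coordinates. *)
Lemma bounded_cluster (u : nat -> X) (M : R) : (forall k, `|u k| <= M) ->
  exists x, forall e N, 0 < e -> exists2 k, (N <= k)%N & `|u k - x| < e.
Proof.
have [f [g [K [K0 fK gK fle]]]] := bounded_coordinates => uM.
have [L L0 gL] := linear_rV_bounded (linearP g).
pose S := [set c : 'rV[R]_n | `|c| <= K * M].
have cS : compact S.
  apply: bounded_closed_compact.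
    exists (K * M); split=> [|r r1 c /= /le_trans]; first exact: num_real.
    by apply; exact: ltW.
  have -> : S = (fun c => `|c|) @^-1` [set r | r <= K * M] by [].
  by apply: closed_comp => [c _|]; [exact: norm_continuous|exact: closed_le].
have [|c [_ cc]] := cS ((f \o u) @ \oo).
  exists 0%N => // k _; apply: (le_trans (fle _)).
  by rewrite ler_wpM2l// ltW.
exists (g c) => e N e0.
have d0 : 0 < e / (L + 1) by rewrite divr_gt0 ?ltr_wpDl.
have FN : ((f \o u) @ \oo) [set c | exists2 k, (N <= k)%N & c = f (u k)].
  by exists N => // k Nk; exists k.
have [_ [[k Nk ->]]] := cc _ _ FN (nbhsx_ballx c _ d0).
rewrite -ball_normE/= ltr_pdivlMr ?ltr_wpDl// => ck.
exists k => //; rewrite -[u k]fK -linearB (le_lt_trans (gL _))//.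
by rewrite distrC; apply: le_lt_trans ck; rewrite mulrC ler_wpM2l// lerDl.
Unshelve. all: by end_near. Qed.

End FiniteDimension.

(** * Relative interiors of convex sets *)
Section Convexity.
Context {R : realType} {X : normedModType R}.
Implicit Types (S C E : set X) (x y z : X) (t : R).

Lemma combE x y t : (1 - t) *: x + t *: y = x + t *: (y - x).
Proof. by rewrite scalerBl scale1r scalerBr addrAC addrA. Qed.

Definition segment_convex S : Prop := forall x y t,
  0 <= t -> t <= 1 -> S x -> S y -> S ((1 - t) *: x + t *: y).

Definition convex_hull S : set X := smallest segment_convex S.

(** The closed affine hull. It agrees with the affine hull in finite dimension;
    closedness is built in so that closure points of S lie in it at once. *)
Definition flat S : set X := smallest (fun T => affine_set T /\ closed T) S.

(** The relative interior in metric form, taken in the closed affine hull so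
    that segments ending at closure points stay in the ambient flat. *)
Definition rint S : set X := [set x | flat S x /\
  exists2 r, 0 < r & forall y, flat S y -> `|y - x| < r -> S y].

Lemma closureP S x :
  closure S x <-> forall e, 0 < e -> exists2 y, S y & `|y - x| < e.
Proof.
split=> [clx e e0|clx].
  have [y [Sy]] := clx _ (nbhsx_ballx x e e0).
  by rewrite -ball_normE/= => xy; exists y => //; rewrite distrC.
move=> U /nbhs_ballP[e /= e0 xU]; have [y Sy yx] := clx e e0.
by exists y; split => //; apply: xU; rewrite -ball_normE/= distrC.
Qed.

Lemma flat_affine S : affine_set (flat S).
Proof.
move=> x y t Sx Sy T TS.
by apply: TS.1.1; [exact: Sx|exact: Sy].
Qed.

Lemma flat_closed S : closed (flat S).
Proof.
move=> x Sx T TS; apply: TS.1.2; apply: closure_subset Sx.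
by move=> y; apply.
Qed.

Lemma convex_hull_convex S : segment_convex (convex_hull S).
Proof.
move=> x y t t0 t1 Sx Sy T TS.
by apply: TS.1 => //; [exact: Sx|exact: Sy].
Qed.

Lemma sub_flat S : S `<=` flat S.
Proof. exact: sub_gen_smallest. Qed.

Lemma rint_sub S : rint S `<=` S.
Proof. by move=> x [Sx [r r0]]; apply => //; rewrite subrr normr0. Qed.

Lemma rint_open S x : rint S x ->
  exists2 r, 0 < r & forall y, flat S y -> `|y - x| < r -> rint S y.
Proof.
move=> [Sx [r r0 rS]]; exists r => // y Sy yx; split => //.
exists (r - `|y - x|); first by rewrite subr_gt0.
move=> z Sz zy; apply: rS => //.
by rewrite -(subrKA y) (le_lt_trans (ler_normD _ _))// -ltrBrDr.
Qed.

(** The ball witnessing that x is in [rint C] meets the affine hull of E, which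
    lies in the flat of C, only in points of [rint C], hence of E. *)
Lemma rint_sub_ri E C : rint C `<=` E -> E `<=` C -> rint C `<=` ri E.
Proof.
move=> CE EC x xC.
have affEC : affine_hull E `<=` flat C.
  apply: smallest_sub; first exact: flat_affine.
  by apply: subset_trans EC _; exact: sub_flat.
have Ex : affine_hull E x by apply: sub_gen_smallest; exact: CE.
rewrite /ri /interior /=.
have [r r0 rC] := rint_open xC.
rewrite /nbhs /=  -nbhs_subspace_in//.
apply/nbhs_ballP; exists r => // y; rewrite -ball_normE/= distrC => yx Ey.
by apply: CE; apply: rC => //; exact: affEC.
Qed.

Lemma ri_sub E : ri E `<=` E.
Proof. exact: (@interior_subset (subspace (affine_hull E))). Qed.

Lemma exists_small_scale (d r : R) : 0 <= d -> 0 < r ->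
  exists2 e, 0 < e & e * d < r.
Proof.
move=> d0 r0; exists (r / (d + 1)); first by rewrite divr_gt0 ?ltr_wpDl.
by rewrite mulrAC ltr_pdivrMr ?ltr_wpDl// mulrDr mulr1 ltrDl.
Qed.

Lemma rint_extend C x z : rint C x -> C z ->
  exists2 e, 0 < e & C (x + e *: (x - z)).
Proof.
move=> [Cx [r r0 rC]] Cz.
have [e e0 er] := exists_small_scale (normr_ge0 (x - z)) r0.
exists e => //; apply: rC; last first.
  by rewrite addrAC subrr add0r normrZ gtr0_norm.
rewrite -[x - z]opprB scalerN -scaleNr -combE.
by apply: (@flat_affine C) => //; exact: sub_flat.
Qed.

(** With y = (1 - t) z + t x, a point y' of the flat near y equals
    (1 - t) z' + t x', where z' in C is close to z and x' is the point of the
    line through z' and y' that corresponds to x; x' is close to x, so it is in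
    C. *)
Lemma rint_segment C x z t : segment_convex C -> rint C x -> closure C z ->
  0 < t -> t <= 1 -> rint C ((1 - t) *: z + t *: x).
Proof.
move=> Ccvx [Cx [r r0 rC]] /closureP clz t0 t1.
have r20 : 0 < r / 2 by rewrite divr_gt0.
have tN0 : t != 0 by rewrite gt_eqF.
set y := (1 - t) *: z + t *: x.
have near_y y' : flat C y' -> `|y' - y| < t * (r / 2) -> C y'.
  move=> Cy' yy'.
  have [z' Cz' zz'] : exists2 z', C z' & `|t^-1 - 1| * `|z' - z| < r / 2.
    have [e e0 er] := exists_small_scale (normr_ge0 (t^-1 - 1)) r20.
    have [z' Cz' zz'] := clz _ e0; exists z' => //.
    apply: le_lt_trans er; rewrite mulrC ler_wpM2r//; exact: ltW.
  pose x' := (1 - t^-1) *: z' + t^-1 *: y'.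
  have xx' : x' - x = t^-1 *: (y' - y) - (t^-1 - 1) *: (z' - z).
    have -> : x = (1 - t^-1) *: z + t^-1 *: y.
      rewrite /y !combE addrAC subrr add0r scalerA mulVf// scale1r.
      by rewrite addrC subrK.
    rewrite /x' opprD addrACA -!scalerBr addrC; congr (_ + _).
    by rewrite -scaleNr opprB.
  have Cx' : C x'.
    apply: rC; first by apply: (@flat_affine C) => //; exact: sub_flat.
    rewrite xx' (le_lt_trans (ler_normB _ _))// !normrZ [ltRHS](splitr r).
    rewrite ltrD// gtr0_norm ?invr_gt0//.
    by rewrite mulrC ltr_pdivrMr// mulrC.
  have -> : y' = (1 - t) *: z' + t *: x'.
    rewrite /x' !combE addrAC subrr add0r scalerA mulfV// scale1r.
    by rewrite addrC subrK.
  by apply: Ccvx => //; exact: ltW.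
have Cz : flat C z.
  apply: flat_closed; apply/closureP => e /clz[c Cc cz].
  by exists c => //; exact: sub_flat.
split.
  by apply: (@flat_affine C) => //; exact: sub_flat.
by exists (t * (r / 2)) => //; rewrite mulr_gt0.
Qed.

End Convexity.

(** * Existence of relative interior points *)
Section RelativeInterior.
Context {R : realType} {X : normedModType R} {n : nat}.
Hypothesis hfin : Vector.axiom n X.
Implicit Types (S C E : set X) (x y z : X) (t : R).

Lemma segment_convex_mean C c (r : seq X) : segment_convex C ->
  C c -> {in r, forall x, C x} ->
  C ((size r).+1%:R^-1 *: (c + \sum_(q <- r) q)).
Proof.
move=> Ccvx Cc; elim/last_ind: r => [|r q IH] rC.
  by rewrite big_nil addr0 invr1 scale1r.
have := IH _; rewrite size_rcons -cats1 big_cat big_seq1/=.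
set k := (size r).+1 => /(_ _)/wrap[x xr|Cm].
  by apply: rC; rewrite mem_rcons inE xr orbT.
have -> : k.+1%:R^-1 *: (c + (\sum_(i <- r) i + q)) =
    (1 - k.+1%:R^-1) *: (k%:R^-1 *: (c + \sum_(i <- r) i)) + k.+1%:R^-1 *: q.
  rewrite addrA scalerDr scalerA; congr (_ *: _ + _).
  rewrite -natr1; field.
  by rewrite natr1 !pnatr_eq0.
apply: Ccvx => //.
  by rewrite invf_le1 ?ler1n// ltr0n.
by apply: rC; rewrite mem_rcons inE eqxx.
Qed.

(** Take finitely many points of C whose directions from x0 span a subspace of
    maximal dimension: adding one more point of C cannot increase the span, so
    that the translated span is a closed affine set containing C, and therefore
    contains the flat of C. The coordinates along the chosen directions are
    linear, hence bounded. *)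
Lemma spanning_directions C x0 : C x0 -> exists (m : nat) (d : 'I_m -> X)
    (a : 'I_m -> X -> R) (K : R),
  [/\ 0 <= K, forall i, C (x0 + d i), forall i v, `|a i v| <= K * `|v| &
    forall y z, flat C y -> flat C z -> y - z = \sum_i a i (y - z) *: d i].
Proof.
move=> Cx0; have [f [g [K [K0 fK gK fle]]]] := bounded_coordinates hfin.
pose dir (s : seq 'rV[R]_n) := {in s, forall v, C (x0 + g v)}.
pose P k := `[< exists2 s, dir s & \dim (span s) = k >].
have P0 : exists k, P k.
  exists 0%N; apply/asboolP; exists [::]; first by move=> v; rewrite inE.
  by rewrite span_nil dimv0.
have Pub k : P k -> (k <= \dim {: 'rV[R]_n})%N.
  by move=> /asboolP[s _ <-]; exact/dimvS/subvf.
case: (ex_maxnP P0 Pub) => k /asboolP[s sdir sk] kmax.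
have sC c : C c -> f (c - x0) \in span s.
  move=> Cc; have ss : (span s <= span (f (c - x0) :: s))%VS.
    by rewrite span_cons addvSr.
  suff /eqP -> : span s == span (f (c - x0) :: s).
    by rewrite memv_span// mem_head.
  rewrite eqEdim ss sk; apply: kmax; apply/asboolP.
  exists (f (c - x0) :: s) => // v; rewrite inE => /predU1P[->|/sdir//].
  by rewrite fK subrKC.
pose a (i : 'I_(size s)) (v : X) : R := coord (in_tuple s) i (f v).
have aspan v : f v \in span s -> v = \sum_i a i v *: g s`_i.
  move=> /(@coord_span _ _ _ (in_tuple s))/(congr1 g); rewrite fK linear_sum.
  by move=> {1}->; apply: eq_bigr => i _; rewrite linearZ.
have coord_bounded i : exists L, 0 <= L /\ forall v, `|a i v| <= L * `|v|.
  have [|L L0 aL] := @linear_rV_bounded _ _ R^o (coord (in_tuple s) i).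
    exact: linearP.
  exists (L * K); split=> [|v]; first by rewrite mulr_ge0// ltW.
  by rewrite (le_trans (aL _))// -mulrA ler_wpM2l.
have [L aL] := choice coord_bounded.
exists (size s), (fun i => g s`_i), a, (\sum_i L i); split.
- by apply: sumr_ge0 => i _; exact: (aL i).1.
- by move=> i; apply: sdir; exact: mem_nth.
- move=> i v; apply: (le_trans ((aL i).2 v)); rewrite ler_wpM2r//.
  by rewrite (bigD1 i)//= lerDl sumr_ge0// => j _; exact: (aL j).1.
pose W := [set y | f (y - x0) \in span s].
have Waff : affine_set W.
  move=> y z t; rewrite /W /= => Wy Wz.
  have -> : (1 - t) *: y + t *: z - x0 =
      (1 - t) *: (y - x0) + t *: (z - x0).
    rewrite !combE addrAC; congr (_ + _ *: _).
    by rewrite opprB addrA subrK.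
  by rewrite linearD !linearZ memvD// memvZ.
have Wclosed : closed W.
  move=> y /closureP Wy.
  pose h c : 'rV[R]_n := c - \sum_i coord (in_tuple s) i c *: s`_i.
  have hlin : linear h.
    move=> b u v; rewrite /h scalerBr scaler_sumr [RHS]addrACA -opprD.
    rewrite -big_split/=; congr (_ - _); apply: eq_bigr => i _.
    by rewrite linearP scalerDl scalerA.
  have [M M0 hM] := linear_rV_bounded hlin.
  have hW v : f v \in span s -> h (f v) = 0.
    move=> /(@coord_span _ _ _ (in_tuple s)) => fv.
    by rewrite /h [X in X - _]fv subrr.
  (* The map h subtracts from a vector its expansion along the family, so it
     vanishes exactly on the span, and it is bounded. *)
  suff : h (f (y - x0)) = 0.
    move=> /eqP; rewrite /h subr_eq0 /W /= => /eqP ->.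
    by apply: memv_suml => i _; rewrite memvZ// memv_span// mem_nth.
  apply/eqP; rewrite -normr_le0; apply/ler_addgt0Pl => e e0.
  have [d d0 de] := exists_small_scale (mulr_ge0 M0 (ltW K0)) e0.
  have [w Ww wy] := Wy _ d0.
  have -> : h (f (y - x0)) = h (f (y - w)).
    have := hlin 1 (f (y - w)) (f (w - x0)).
    by rewrite !scale1r -linearD subrKA [h (f (w - x0))]hW// addr0.
  rewrite addr0; apply: (le_trans (hM _)); apply: le_trans (ltW de).
  rewrite [leRHS]mulrC -mulrA ler_wpM2l// (le_trans (fle _))//.
  by rewrite ler_wpM2l ?(ltW K0)// distrC ltW.
have CW : flat C `<=` W by apply: smallest_sub.
move=> y z /CW Wy /CW Wz; apply: aspan.
have -> : y - z = (y - x0) - (z - x0) by rewrite opprB subrKA.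
by rewrite linearB memvB.
Qed.

(** The points x0 + sum w_i d_i with 0 <= w_i <= 1/(m+1) are means of x0 and m
    points of the segments from x0 to x0 + d_i, so they are in C. The point with
    all weights 1/(2(m+1)) is interior: moving it within the flat changes the
    weights by small amounts. *)
Lemma rint_nonempty C : segment_convex C -> C !=set0 -> rint C !=set0.
Proof.
move=> Ccvx [x0 Cx0].
have [m [d [a [K [K0 Cd aK span]]]]] := spanning_directions Cx0.
have m0 : 0 < m.+1%:R :> R by rewrite ltr0n.
have simplex (w : 'I_m -> R) : (forall i, 0 <= w i <= m.+1%:R^-1) ->
    C (x0 + \sum_i w i *: d i).
  move=> w01; pose q i := x0 + (m.+1%:R * w i) *: d i.
  have Cq i : C (q i).
    have /andP[w0 w1] := w01 i.
    have := Ccvx x0 (x0 + d i) (m.+1%:R * w i).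
    rewrite combE addrAC subrr add0r.
    by apply => //; rewrite ?mulr_ge0// -ler_pdivlMl// mulr1.
  have := @segment_convex_mean C x0 [seq q i | i <- enum 'I_m] Ccvx Cx0.
  rewrite size_map size_enum_ord big_map big_enum/= big_split/= sumr_const.
  rewrite card_ord addrA -mulrS scalerDr.
  rewrite -[x0 *+ _]scaler_nat scalerA mulVf ?gt_eqF//.
  rewrite scale1r scaler_sumr.
  rewrite (eq_bigr (fun i => w i *: d i)) => [|i _].
    by apply => _ /mapP[i _ ->].
  by rewrite scalerA mulrA mulVf ?gt_eqF// mul1r.
pose b : R := (m.+1%:R * 2)^-1.
have b0 : 0 < b by rewrite invr_gt0 mulr_gt0.
have [r r0 rb] := exists_small_scale K0 b0.
pose x := x0 + \sum_i b *: d i.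
have Cx : flat C x.
  apply: sub_flat; apply: simplex => i; rewrite ltW//=.
  by rewrite lef_pV2 ?posrE ?mulr_gt0// ler_peMr ?ler1n// ltW.
exists x; split => //; exists r => // y Cy yx.
rewrite -(subrK x y) (span _ _ Cy Cx) addrC /x -addrA -big_split/=.
rewrite (eq_bigr (fun i => (b + a i (y - x)) *: d i)) => [|i _]; last first.
  by rewrite scalerDl.
apply: simplex => i.
have : `|a i (y - x)| <= b.
  rewrite (le_trans (aK _ _))// (le_trans _ (ltW rb))// mulrC ler_wpM2r//.
  exact: ltW.
rewrite ler_norml => /andP[? ?].
have -> : m.+1%:R^-1 = b + b :> R.
  by rewrite /b invfM -mulrDr -[2^-1]mul1r -splitr mulr1.
by apply/andP; split; lra.
Qed.

End RelativeInterior.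

(** * Nearly convex sets *)
Section NearConvexity.
Context {R : realType} {X : normedModType R} {n : nat}.
Hypothesis hfin : Vector.axiom n X.
Implicit Types (S C E : set X) (x y z : X) (s t : R).

Definition nearly_convex E : Prop :=
  exists C, [/\ segment_convex C, rint C `<=` E & E `<=` C].

(** Covers the Minkowski sum (s = 1) and the Minkowski difference (s = -1) at
    once. *)
Definition set_comb s C1 C2 : set X := [set x + s *: y | x in C1 & y in C2].

Lemma set_addE S T : set_add S T = set_comb 1 S T.
Proof.
by apply/seteqP; split=> _ [x Sx [y Ty <-]]; exists x => //; exists y;
  rewrite ?scale1r.
Qed.

Lemma set_subE S T : set_sub S T = set_comb (-1) S T.
Proof.
by apply/seteqP; split=> _ [x Sx [y Ty <-]]; exists x => //; exists y;
  rewrite ?scaleN1r.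
Qed.

Lemma comb_interchange s t x1 x2 y1 y2 :
  (1 - t) *: (x1 + s *: x2) + t *: (y1 + s *: y2) =
  ((1 - t) *: x1 + t *: y1) + s *: ((1 - t) *: x2 + t *: y2).
Proof.
by rewrite !scalerDr addrACA !scalerA ![s * _]mulrC.
Qed.

Lemma segment_convex_comb s C1 C2 : segment_convex C1 -> segment_convex C2 ->
  segment_convex (set_comb s C1 C2).
Proof.
move=> cvx1 cvx2 _ _ t t0 t1 [x1 Cx1 [x2 Cx2 <-]] [y1 Cy1 [y2 Cy2 <-]].
rewrite comb_interchange.
exists ((1 - t) *: x1 + t *: y1); first exact: cvx1.
by exists ((1 - t) *: x2 + t *: y2) => //; exact: cvx2.
Qed.

(** Extend the segment from a point a + s b, with a and b relatively interior,
    to x a little beyond x, to a point a' + s b'. Then x is strictly between the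
    two, and its components are strictly between a' and a, and between b' and
    b. *)
Lemma rint_comb s C1 C2 : segment_convex C1 -> segment_convex C2 ->
  rint (set_comb s C1 C2) `<=` set_comb s (rint C1) (rint C2).
Proof.
move=> cvx1 cvx2 x xC; have [c1 Cc1 [c2 Cc2 _]] := rint_sub xC.
have [|a aC] := rint_nonempty hfin cvx1; first by exists c1.
have [|b bC] := rint_nonempty hfin cvx2; first by exists c2.
have ab : set_comb s C1 C2 (a + s *: b).
  by exists a; [exact: rint_sub|exists b => //; exact: rint_sub].
have [e e0 [a' Ca' [b' Cb' abE]]] := rint_extend xC ab.
(* The weight that brings x + e (x - u) back to x when averaged with u. *)
pose t := e / (1 + e).
have e1 : 0 < 1 + e by rewrite addr_gt0.
have t0 : 0 < t by rewrite divr_gt0.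
have t1 : t <= 1 by rewrite ler_pdivrMr// mul1r lerDr.
have -> : x = (1 - t) *: (a' + s *: b') + t *: (a + s *: b).
  rewrite abE combE; move: (a + s *: b) => u.
  have -> : u - (x + e *: (x - u)) = - ((1 + e) *: (x - u)).
    by rewrite scalerDl scale1r !opprD addrA opprK [- x + u]addrC.
  by rewrite scalerN scalerA divfK ?gt_eqF// addrK.
rewrite comb_interchange; exists ((1 - t) *: a' + t *: a).
  by apply: rint_segment => //; exact: subset_closure.
exists ((1 - t) *: b' + t *: b) => //.
by apply: rint_segment => //; exact: subset_closure.
Qed.

Lemma nearly_convex_comb s E1 E2 : nearly_convex E1 -> nearly_convex E2 ->
  nearly_convex (set_comb s E1 E2).
Proof.
move=> [C1 [cvx1 CE1 EC1]] [C2 [cvx2 CE2 EC2]].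
exists (set_comb s C1 C2); split; first exact: segment_convex_comb.
  move=> _ /(rint_comb cvx1 cvx2)[x /CE1 Ex [y /CE2 Ey <-]].
  by exists x => //; exists y.
move=> _ [x /EC1 Cx [y /EC2 Cy <-]].
by exists x => //; exists y.
Qed.

(** If a and b are relatively interior in C1 and C2, then b - a is some d - c
    with d in E1 and c in E2, and the midpoint of d and a is also the midpoint
    of c and b: a common relatively interior point. Segments from a common
    closure point to it consist of such points. *)
Lemma closure_ri_meet E1 E2 : nearly_convex E1 -> nearly_convex E2 ->
  set_sub E1 E2 = setT ->
  closure E1 `&` closure E2 `<=` closure (ri E1 `&` ri E2).
Proof.
move=> [C1 [cvx1 CE1 EC1]] [C2 [cvx2 CE2 EC2]] subT.
have E12 z : exists x y, [/\ E1 x, E2 y & x - y = z].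
  have : set_sub E1 E2 z by rewrite subT.
  by move=> [x E1x [y E2y <-]]; exists x, y.
have [x1 [y1 [E1x1 E2y1 _]]] := E12 0.
have [|a aC] := rint_nonempty hfin cvx1; first by exists x1; exact: EC1.
have [|b bC] := rint_nonempty hfin cvx2; first by exists y1; exact: EC2.
have [p aCp bCp] : exists2 p, rint C1 p & rint C2 p.
  have [d [c [/EC1 Cd /EC2 Cc dcE]]] := E12 (b - a).
  exists ((1 - 2^-1) *: d + 2^-1 *: a).
    by apply: rint_segment => //; [exact: subset_closure|lra].
  have -> : (1 - 2^-1) *: d + 2^-1 *: a = (1 - 2^-1) *: c + 2^-1 *: b.
    have -> : 1 - 2^-1 = 2^-1 :> R by lra.
    rewrite -!scalerDr; congr (_ *: _).
    by move/eqP: dcE; rewrite subr_eq => /eqP ->; rewrite addrAC subrK addrC.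
  by apply: rint_segment => //; [exact: subset_closure|lra].
move=> z [z1 z2]; apply/closureP => e e0.
have [r r0 rb] := exists_small_scale (normr_ge0 (p - z)) e0.
pose t := Num.min r 1.
have t0 : 0 < t by rewrite lt_min r0 ltr01.
have t1 : t <= 1 by rewrite ge_min lexx orbT.
exists ((1 - t) *: z + t *: p).
  split; [apply: (rint_sub_ri CE1 EC1)|apply: (rint_sub_ri CE2 EC2)];
    by apply: rint_segment => //;
      (exact: closure_subset z1 || exact: closure_subset z2).
rewrite combE addrAC subrr add0r normrZ gtr0_norm//.
by rewrite (le_lt_trans _ rb)// ler_wpM2r// ge_min lexx.
Qed.

End NearConvexity.

(** * Inner product estimates *)
Section InnerProduct.
Context {R : realType} {X : normedModType R} {n : nat}.
Hypothesis hfin : Vector.axiom n X.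
Context (dot : {dot X for @idfun R}).
Hypothesis hdot : forall x : X, `|x| ^+ 2 = dot x x.
Implicit Types (x y z u v w : X) (t : R).

Lemma dotC x y : dot x y = dot y x.
Proof. by rewrite hermC expr0 mul1r. Qed.

Lemma dotDl x y z : dot (x + y) z = dot x z + dot y z.
Proof. exact: linearDl. Qed.

Lemma dotNl x z : dot (- x) z = - dot x z.
Proof. exact: linearNl. Qed.

Lemma dotZl t x z : dot (t *: x) z = t * dot x z.
Proof. exact: linearZl_LR. Qed.

Lemma dotDr x y z : dot z (x + y) = dot z x + dot z y.
Proof. by rewrite dotC dotDl !(dotC _ z). Qed.

Lemma dotNr x z : dot z (- x) = - dot z x.
Proof. by rewrite dotC dotNl dotC. Qed.

Lemma dotZr t x z : dot z (t *: x) = t * dot z x.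
Proof. by rewrite dotC dotZl dotC. Qed.

Definition dotE := (dotDl, dotDr, dotNl, dotNr, dotZl, dotZr).

Lemma dot_ge0 x : 0 <= dot x x.
Proof. by rewrite -hdot sqr_ge0. Qed.

Lemma dot_eq0 x : dot x x <= 0 -> x = 0.
Proof.
rewrite -hdot => x0; apply/eqP; rewrite -normr_eq0 -sqrf_eq0.
by rewrite eq_le x0 sqr_ge0.
Qed.

Lemma cauchy_schwarz x y : dot x y <= `|x| * `|y|.
Proof.
have [->|x0] := eqVneq x 0.
  by rewrite -(scale0r 0) dotZl mul0r mulr_ge0.
have [->|y0] := eqVneq y 0.
  by rewrite -(scale0r 0) dotZr mul0r mulr_ge0.
have xy0 : 0 < `|x| * `|y| by rewrite mulr_gt0 ?normr_gt0.
have := dot_ge0 (`|y| *: x - `|x| *: y).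
rewrite !dotE (dotC y x) -!hdot => h.
rewrite -(ler_pM2l xy0); move: h.
set a := `|x|; set b := `|y|; set c := dot x y.
nra.
Qed.

(** Reduces a vector identity to a scalar one, which the [ring] tactic can
    prove. *)
Lemma vec_eq x y : (forall z, dot x z = dot y z) -> x = y.
Proof.
move=> xy; apply/eqP; rewrite -subr_eq0; apply/eqP; apply: dot_eq0.
by rewrite dotDl dotNl xy subrr.
Qed.

(** Passage to the limit at a cluster point, for functions with a one-sided
    Lipschitz bound there. *)
Lemma cluster_le (u : nat -> X) x (f : X -> R) (L b c : R) : 0 <= L ->
  (forall e N, 0 < e -> exists2 k, (N <= k)%N & `|u k - x| < e) ->
  (forall v, f x <= f v + L * `|v - x|) ->
  (forall k, f (u k) <= b + c * k.+1%:R^-1) -> f x <= b.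
Proof.
move=> L0 ux flip fu; apply/ler_addgt0Pr => e e0.
have e20 : 0 < e / 2 by rewrite divr_gt0.
have [d d0 dL] := exists_small_scale L0 e20.
have [a a0 ac] := exists_small_scale (normr_ge0 c) e20.
have [N _ Na] := near_infty_natSinv_lt (PosNum a0).
have [k /Na /= ka kd] := ux d N d0.
apply: (le_trans (flip (u k))); rewrite [e]splitr addrA.
have h1 : L * `|u k - x| <= e / 2.
  by apply/ltW/(le_lt_trans _ dL); rewrite mulrC ler_wpM2r// ltW.
have h2 : c * k.+1%:R^-1 <= e / 2.
  apply/ltW/(le_lt_trans _ ac); apply: (@le_trans _ _ (`|c| * k.+1%:R^-1)).
    by rewrite ler_wpM2r// ler_norm.
  by rewrite mulrC ler_wpM2r// ltW.
by rewrite lerD// (le_trans (fu k))// lerD2l.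
Qed.

(** A uniform boundedness principle that only tests the sequence against its own
    terms. If p were unbounded, normalized terms v with |p| large would cluster
    at some x with <p j, x> <= 0 for all j, so <v, x> <= 0 for the unit vectors
    v that cluster at x, which is absurd. *)
Lemma pairwise_bounded (p : nat -> X) :
  (forall j, exists M, forall k, dot (p j) (p k) <= M) ->
  exists M, forall k, `|p k| <= M.
Proof.
move=> pM; apply: contrapT => unb.
have /choice[s ps] m : exists k, m.+1%:R < `|p k|.
  apply: contrapT => pm; apply: unb; exists m.+1%:R => k.
  by rewrite leNgt; apply/negP => kp; apply: pm; exists k.
have s0 m : 0 < `|p (s m)| by apply: lt_trans (ps m); rewrite ltr0n.
pose v m := `|p (s m)|^-1 *: p (s m).
have v1 m : `|v m| = 1 by rewrite normrZ normfV normr_id mulVf// gt_eqF.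
have [|x vx] := @bounded_cluster _ _ _ hfin v 1; first by move=> m; rewrite v1.
have px j : dot (p j) x <= 0.
  have [M jM] := pM j.
  apply: (@cluster_le v x (dot (p j)) `|p j| _ `|M|) => // [y|m].
    have := cauchy_schwarz (p j) (x - y); rewrite dotDr dotNr distrC; lra.
  rewrite add0r dotZr mulrC; apply: (@le_trans _ _ (`|M| * `|p (s m)|^-1)).
    by rewrite ler_wpM2r ?invr_ge0// (le_trans (jM _))// ler_norm.
  by rewrite ler_wpM2l// lef_pV2 ?posrE// ltW.
have [m _ mx] := vx 1 0%N ltr01.
have vx0 : dot (v m) x <= 0.
  by rewrite dotZl mulr_ge0_le0// invr_ge0.
have := cauchy_schwarz (v m) (v m - x).
by rewrite dotDr dotNr -hdot v1; lra.
Qed.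

End InnerProduct.

(** * Minty's theorem *)
Section MaximallyMonotone.
Context {R : realType} {X : normedModType R} {n : nat}.
Hypothesis hfin : Vector.axiom n X.
Context (dot : {dot X for @idfun R}).
Hypothesis hdot : forall x : X, `|x| ^+ 2 = dot x x.
Implicit Types (A B : X -> set X) (x y z u v w : X) (t : R).

Local Notation dotC := (dotC dot).
Local Notation dotE := (dotE dot).
Local Notation dot_ge0 := (dot_ge0 hdot).

(** Maximality in the form in which it is used: every pair monotonically related
    to the graph is in the graph. *)
Definition saturated A : Prop := forall x u,
  (forall z w, A z w -> 0 <= dot (x - z) (u - w)) -> A x u.

Lemma maximally_monotone_saturated A : maximally_monotone dot A -> saturated A.
Proof.
move=> [Amon Amax] x u xu.
pose A' y := A y `|` [set v | y = x /\ v = u].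
apply: (Amax A' _ _ (x, u)); last by right.
- move=> y z v w [Ayv|[-> ->]] [Azw|[-> ->]].
  + exact: Amon.
  + have := xu _ _ Ayv; rewrite -(opprB y x) -(opprB v u) dotNl dotNr opprK//.
  + exact: xu.
  + by rewrite !subrr dot_ge0.
- by move=> [y v] /= Ayv; left.
Qed.

(** G is the epigraph of the Fitzpatrick function of A, and E that of the
    conjugate of that function with its arguments exchanged. E is convex,
    contains (z, w, <z, w>) for (z, w) in the graph, is contained in G, and
    satisfies r >= <z, w>. So r + |z - w|^2/4 >= |z + w|^2/4 >= 0 on E. A
    minimizing sequence has differences u = z - w clustering at some u0; the
    strong convexity of the functional in z - w turns minimality into
    |u0 - (z - w)|^2/4 <= r + |z - w|^2/4 - m for (z, w, r) in E, where m >= 0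
    is the infimum. On the graph this says that (u0/2, -u0/2) is monotonically
    related to A. *)
Lemma minty_zero A : monotone_op dot A -> saturated A -> exists x, A x (- x).
Proof.
move=> Amon Asat.
have [z0 [w0 A0]] : exists z w, A z w.
  apply: contrapT => A0; apply: (A0); exists 0, 0; apply: Asat => z w Azw.
  by exfalso; apply: A0; exists z, w.
pose G z w r := forall z' w', A z' w' ->
  dot z w' + dot z' w <= r + dot z' w'.
pose E z w r := forall z' w' r', G z' w' r' ->
  dot z w' + dot z' w <= r + r'.
have AE z w : A z w -> E z w (dot z w).
  by move=> Azw z' w' r' /(_ _ _ Azw); lra.
have AG z w : A z w -> G z w (dot z w).
  move=> Azw z' w' Azw'; have := Amon _ _ _ _ Azw Azw'.
  by rewrite !dotE; lra.
have Ege z w r : E z w r -> dot z w <= r.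
  move=> Er; suff /Er : G z w r by lra.
  by move=> z' w' /AG/Er.
have Ecvx t z w r z' w' r' : 0 <= t -> t <= 1 -> E z w r -> E z' w' r' ->
    E (z + t *: (z' - z)) (w + t *: (w' - w)) (r + t * (r' - r)).
  move=> t0 t1 E1 E2 z2 w2 r2 G2.
  have h1 := E1 _ _ _ G2; have h2 := E2 _ _ _ G2.
  by rewrite !dotE; nra.
pose h z w (r : R) := r + dot (z - w) (z - w) / 4.
pose H := [set q | exists z w r, E z w r /\ q = h z w r].
have Hge0 : lbound H 0.
  move=> _ [z [w [r [/Ege Er ->]]]].
  by rewrite /h; have := dot_ge0 (z + w); rewrite !dotE (dotC w z); lra.
have Hne : H !=set0.
  by exists (h z0 w0 (dot z0 w0)), z0, w0, (dot z0 w0); split => //; exact: AE.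
have Hinf : has_inf H by split => //; exists 0.
pose m := inf H.
have m0 : 0 <= m by exact: lb_le_inf.
have Em z w r : E z w r -> m <= h z w r.
  by move=> Ezwr; apply: ge_inf; [exists 0|exists z, w, r].
have /choice[u Pu] k : exists u, exists z w r,
    [/\ E z w r, u = z - w & h z w r < m + k.+1%:R^-1].
  have [|_ [z [w [r [Er ->]]]] hk] := @inf_adherent _ H k.+1%:R^-1 _ Hinf.
    by rewrite invr_gt0 ltr0n.
  by exists (z - w), z, w, r.
(* Compare m with the value at the convex combination of the k-th term of the
   minimizing sequence and an arbitrary point of E. *)
have key k t z w r : 0 < t -> t <= 1 -> E z w r ->
    (1 - t) / 4 * dot (u k - (z - w)) (u k - (z - w)) <=
    h z w r - m + t^-1 * k.+1%:R^-1.
  move=> t0 t1 Er; have [zk [wk [rk [Ek -> hk]]]] := Pu k.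
  rewrite -(ler_pM2l t0) [leRHS]mulrDr [t * (t^-1 * _)]mulrA mulfV ?gt_eqF//.
  rewrite mul1r.
  have := Em _ _ _ (Ecvx t _ _ _ _ _ _ (ltW t0) t1 Ek Er).
  set d := k.+1%:R^-1 in hk *.
  rewrite /h.
  have -> : zk + t *: (z - zk) - (wk + t *: (w - wk)) =
     (1 - t) *: (zk - wk) + t *: (z - w).
    by apply: (vec_eq hdot) => y; rewrite !dotE; ring.
  move: hk; rewrite /h; move: (zk - wk) (z - w) => a b hk.
  rewrite !dotE (dotC b a).
  have d0 : 0 < d by rewrite invr_gt0 ltr0n.
  move: hk; move: (dot a a) (dot a b) (dot b b) => aa ab bb hk.
  have h1 : 0 <= (1 - t) * (m + d - (rk + aa / 4)).
    by rewrite mulr_ge0// subr_ge0// ltW.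
  have h2 : 0 <= t * d by rewrite mulr_ge0// ltW.
  lra.
have bnd k : dot (u k - (z0 - w0)) (u k - (z0 - w0)) <=
    8 * (h z0 w0 (dot z0 w0) - m + 2).
  have h02 : 0 < 2^-1 :> R by rewrite invr_gt0.
  have h12 : 2^-1 <= 1 :> R by lra.
  have := key k 2^-1 _ _ _ h02 h12 (AE _ _ A0); rewrite invrK.
  have : k.+1%:R^-1 <= 1 :> R by rewrite invf_le1 ?ltr0n// ler1n.
  move: (k.+1%:R^-1) (h _ _ _) (dot _ _) => d b c.
  lra.
have [M uM] : exists M, forall k, `|u k| <= M.
  set B := 8 * _ in bnd; exists (B + 1 + `|z0 - w0|) => k.
  rewrite -(subrK (z0 - w0) (u k)) (le_trans (ler_normD _ _))// lerD2r.
  have := bnd k; rewrite -hdot; nra.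
have [u0 u0P] := bounded_cluster hfin uM.
have lim z w r : E z w r ->
    dot (u0 - (z - w)) (u0 - (z - w)) / 4 <= h z w r - m.
  move=> Er; apply/ler_addgt0Pr => e e0.
  set N := dot _ _.
  have N0 : 0 <= N / 4 by rewrite divr_ge0 ?dot_ge0.
  have [d d0 dN] := exists_small_scale N0 e0.
  pose t := Num.min d 1.
  have t0 : 0 < t by rewrite lt_min d0 ltr01.
  have t1 : t <= 1 by rewrite ge_min lexx orbT.
  have td : t * (N / 4) <= e.
    by rewrite (le_trans _ (ltW dN))// ler_wpM2r// ge_min lexx.
  suff : (1 - t) / 4 * N <= h z w r - m by lra.
  have t40 : 0 <= (1 - t) / 4 by rewrite divr_ge0// subr_ge0.
  apply: (@cluster_le _ _ u u0
    (fun v => (1 - t) / 4 * dot (v - (z - w)) (v - (z - w)))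
    ((1 - t) / 4 * (2 * `|u0 - (z - w)|)) _ t^-1) => //.
  - by apply: mulr_ge0 => //; apply: mulr_ge0.
  - move=> v; rewrite -[X in _ <= _ + X]mulrA -mulrDr ler_wpM2l//.
    have := cauchy_schwarz hdot (u0 - (z - w)) (u0 - v); rewrite (distrC u0 v).
    have := dot_ge0 (u0 - v).
    move: (z - w) => c.
    rewrite /N !dotE (dotC v u0) (dotC c u0) (dotC c v); lra.
  - by move=> k; exact: key.
exists (2^-1 *: u0); apply: Asat => z w Azw.
have := lim _ _ _ (AE _ _ Azw); rewrite /h; move: m0.
rewrite !dotE (dotC w z) (dotC z u0) (dotC w u0).
lra.
Qed.
End MaximallyMonotone.

(** * Near convexity of domains and ranges *)
Section DomainAndRange.
Context {R : realType} {X : normedModType R} {n : nat}.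
Hypothesis hfin : Vector.axiom n X.
Context (dot : {dot X for @idfun R}).
Hypothesis hdot : forall x : X, `|x| ^+ 2 = dot x x.
Implicit Types (A B : X -> set X) (x y z u v w : X) (t : R).

Local Notation dotC := (dotC dot).
Local Notation dotE := (dotE dot).
Local Notation dot_ge0 := (dot_ge0 hdot).

(** The case y = 0, l = 1 applied to the operator l A - y, which is again
    maximally monotone. *)
Lemma minty A (l : R) y : monotone_op dot A -> saturated dot A -> 0 < l ->
  exists x, A x (l^-1 *: (y - x)).
Proof.
move=> Amon Asat l0; have lN0 : l != 0 by rewrite gt_eqF.
pose A' x := [set v | A x (l^-1 *: (y + v))].
have [||x] := @minty_zero _ _ _ hfin dot hdot A'; last by exists x.
- move=> z z' v v' /= Av Av'; have := Amon _ _ _ _ Av Av'.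
  by rewrite -scalerBr dotZr opprD addrACA subrr add0r pmulr_rge0 ?invr_gt0.
- move=> x v xv; apply: Asat => z w Azw.
  have := xv z (l *: w - y); rewrite /A' /= addrC subrK scalerA mulVf//.
  rewrite scale1r => /(_ Azw) h; rewrite -(pmulr_rge0 _ l0) -dotZr.
  rewrite scalerBr scalerA mulfV// scale1r.
  by rewrite opprB addrA [v + y]addrC in h.
Qed.

Lemma monotone_inv A : monotone_op dot A -> monotone_op dot (op_inv A).
Proof. by move=> Amon u v x y Ax Ay; rewrite dotC; exact: Amon. Qed.

Lemma saturated_inv A : saturated dot A -> saturated dot (op_inv A).
Proof.
by move=> Asat u x ux; apply: Asat => z w Azw; rewrite dotC; exact: ux.
Qed.

Lemma ran_dom_inv A : ran A = dom (op_inv A).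
Proof.
apply/seteqP; split=> [u [x _ Axu]|u [x Axu]]; first by exists x.
by exists x.
Qed.

(** Let x be relatively interior in C = conv (dom A), and let p_k be the Yosida
    approximation of A at x with parameter 1/(k+1), so that p_k is in
    A (x - p_k/(k+1)). Monotonicity bounds <z - x, p_k> above for z in dom A,
    hence for z in C. As p_k is a multiple of x - x_k with x_k in dom A, and C
    contains points beyond x on the line from x_k to x, all the products
    <p_j, p_k> are bounded above for fixed j, so the sequence p is bounded. A
    cluster point q of p is in A x by saturation. *)
Lemma nearly_convex_dom A : monotone_op dot A -> saturated dot A ->
  nearly_convex (dom A).
Proof.
move=> Amon Asat; exists (convex_hull (dom A)); split.
- exact: convex_hull_convex.
- move=> x xC.
  have /choice[p Ap] k : exists p, A (x - k.+1%:R^-1 *: p) p.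
    have k0 : 0 < k.+1%:R^-1 :> R by rewrite invr_gt0 ltr0n.
    have [y Ay] := minty x Amon Asat k0; exists (k.+1%:R^-1^-1 *: (x - y)).
    by rewrite scalerA mulfV ?gt_eqF// scale1r subKr.
  have pz k z w : A z w ->
      0 <= dot (x - z) (p k - w) - k.+1%:R^-1 * dot (p k) (p k - w).
    move=> /(Amon _ _ _ _ (Ap k)); move: (k.+1%:R^-1) => d; rewrite !dotE.
    lra.
  have bound_hull z : convex_hull (dom A) z ->
      exists M, forall k, dot (z - x) (p k) <= M.
    move: z; apply: smallest_sub => [y z t t0 t1 [M yM] [N zN]|z [w Azw]].
      exists ((1 - t) * M + t * N) => k; rewrite combE.
      have := yM k; have := zN k; rewrite !dotE.
      move: (dot z _) (dot y _) (dot x _) => a b c h1 h2.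
      nra.
    exists (dot (z - x) w + dot w w) => k; have := pz k _ _ Azw.
    have := dot_ge0 (p k - 2^-1 *: w); have := dot_ge0 w.
    have : k.+1%:R^-1 <= 1 :> R by rewrite invf_le1 ?ltr0n// ler1n.
    have : 0 <= k.+1%:R^-1 :> R by rewrite invr_ge0 ler0n.
    move: (k.+1%:R^-1) (p k) => d q d0 d1.
    rewrite !dotE (dotC w q).
    move: (dot q q) (dot q w) (dot w w) => qq qw ww ww0 h.
    move: (dot x q) (dot x w) (dot z q) (dot z w) => xq xw zq zw h2.
    nra.
  have [j|M pM] := @pairwise_bounded _ _ _ hfin dot hdot p.
    have Cj : convex_hull (dom A) (x - j.+1%:R^-1 *: p j).
      by apply: sub_gen_smallest; exists (p j); exact: Ap.
    have [e e0 /bound_hull[M eM]] := rint_extend xC Cj.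
    exists (e^-1 * (j.+1%:R * M)) => k.
    have := eM k; rewrite addrAC subrr add0r subKr.
    rewrite !dotZl => h.
    rewrite ler_pdivlMl// -ler_pdivrMl ?ltr0n//.
    by rewrite mulrCA.
  have [q qP] := bounded_cluster hfin pM.
  exists q; apply: Asat => z w Azw; rewrite -oppr_le0.
  apply: (@cluster_le _ _ p q (fun v => - dot (x - z) (v - w))
    `|x - z| 0 (M * `|w|)) => // [v|k].
    have := cauchy_schwarz hdot (x - z) (v - q).
    by rewrite !dotDr !dotNr; lra.
  rewrite add0r; have := pz k _ _ Azw.
  have h : dot (p k) (w - p k) <= M * `|w|.
    have := cauchy_schwarz hdot (p k) w; have := dot_ge0 (p k).
    have : `|p k| * `|w| <= M * `|w| by rewrite ler_wpM2r.
    by rewrite dotDr dotNr; lra.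
  have d0 : 0 <= k.+1%:R^-1 :> R by rewrite invr_ge0 ler0n.
  have := ler_wpM2l d0 h; move: (k.+1%:R^-1) => d; rewrite !dotE; lra.
- exact: sub_gen_smallest.
Qed.

Lemma nearly_convex_ran A : monotone_op dot A -> saturated dot A ->
  nearly_convex (ran A).
Proof.
move=> Amon Asat; rewrite ran_dom_inv.
by apply: nearly_convex_dom; [exact: monotone_inv|exact: saturated_inv].
Qed.

End DomainAndRange.

(** * The displacement range of the Douglas-Rachford operator *)
Section DouglasRachford.
Context {R : realType} {X : normedModType R} {n : nat}.
Hypothesis hfin : Vector.axiom n X.
Context (dot : {dot X for @idfun R}).
Hypothesis hdot : forall x : X, `|x| ^+ 2 = dot x x.
Context (A B : X -> set X).
Hypotheses (Amon : monotone_op dot A) (Asat : saturated dot A).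
Hypotheses (Bmon : monotone_op dot B) (Bsat : saturated dot B).
Implicit Types (x y z u v w : X) (t : R).

Local Notation dotC := (dotC dot).
Local Notation dotE := (dotE dot).
Local Notation dot_ge0 := (dot_ge0 hdot).

Lemma resolvent_mem C x : monotone_op dot C -> saturated dot C ->
  C (resolvent C x) (x - resolvent C x).
Proof.
move=> Cmon Csat; rewrite /resolvent.
have [y Cy] := minty hfin hdot x Cmon Csat ltr01.
case: xgetP => [z _ [_ -> [v Czv <-]]|/(_ y) []].
  by rewrite addrC addKr.
exists y => //; exists (x - y); last by rewrite addrC subrK.
by rewrite invr1 scale1r in Cy.
Qed.

Lemma resolvent_eq C y v : monotone_op dot C -> saturated dot C -> C y v ->
  resolvent C (y + v) = y.
Proof.
move=> Cmon Csat Cyv; set z := resolvent C (y + v).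
have Cz : C z (y + v - z) by exact: resolvent_mem.
have := Cmon _ _ _ _ Cyv Cz.
have -> : v - (y + v - z) = - (y - z).
  by rewrite !opprD !opprK addrA addrCA subrr addr0.
rewrite dotNr oppr_ge0 => /(dot_eq0 hdot)/eqP.
by rewrite subr_eq0 eq_sym => /eqP.
Qed.

Lemma displacement_mem x : exists a b u v,
  [/\ A a u, B b v, x = a + u, x - douglas_rachford A B x = a - b &
      a - b = u + v].
Proof.
pose a := resolvent A x; pose b := resolvent B (2 *: a - x).
exists a, b, (x - a), (2 *: a - x - b); split.
- exact: resolvent_mem.
- exact: resolvent_mem.
- by rewrite addrC subrK.
- rewrite /douglas_rachford /reflected_resolvent -/a -/b.
  by apply: (vec_eq hdot) => y; rewrite !dotE; field.
- by apply: (vec_eq hdot) => y; rewrite !dotE; ring.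
Qed.

Lemma displacement_rangeP w : displacement_range A B w <->
  exists a b u v, [/\ A a u, B b v, w = a - b & w = u + v].
Proof.
split=> [[x _ <-]|[a [b [u [v [Aau Bbv wab wuv]]]]]].
  have [a [b [u [v [Aau Bbv xau -> abuv]]]]] := displacement_mem x.
  by exists a, b, u, v.
have abuv z : dot a z - dot b z = dot u z + dot v z.
  by rewrite -dotNl -!dotDl -wab wuv.
exists (a + u) => //; rewrite /douglas_rachford /reflected_resolvent.
rewrite (resolvent_eq Amon Asat Aau).
have -> : 2 *: a - (a + u) = b + v.
  by apply: (vec_eq hdot) => z; have := abuv z; rewrite !dotE; lra.
rewrite (resolvent_eq Bmon Bsat Bbv) wab.
by apply: (vec_eq hdot) => z; have := abuv z; rewrite !dotE; lra.
Qed.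

Let M x := x - douglas_rachford A B x.

(** The difference of the two sides is the sum of the monotonicity products of A
    and of B. *)
Lemma displacement_firmly_nonexpansive x y :
  dot (M x - M y) (M x - M y) <= dot (x - y) (M x - M y).
Proof.
have [a [b [u [v [Aau Bbv xau]]]]] := displacement_mem x.
rewrite -/(M x) => Mx abuv.
have [a' [b' [u' [v' [Aau' Bbv' xau']]]]] := displacement_mem y.
rewrite -/(M y) => My abuv'.
have := Amon Aau Aau'; have := Bmon Bbv Bbv'.
have MD : M x - M y = (a - a') - (b - b').
  by rewrite Mx My; apply: (vec_eq hdot) => z; rewrite !dotE; ring.
have MD' : M x - M y = (u - u') + (v - v').
  by rewrite Mx My abuv abuv'; apply: (vec_eq hdot) => z; rewrite !dotE; ring.
have -> : x - y = (a - a') + (u - u').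
  by rewrite xau xau'; apply: (vec_eq hdot) => z; rewrite !dotE; ring.
move: MD MD'; move: (M x - M y) (a - a') (b - b') (u - u') (v - v').
move=> m da db du dv mab muv.
have -> : dot (da + du) m = dot da (du + dv) + dot du (da - db).
  by rewrite -mab -muv dotDl.
have -> : dot m m = dot (da - db) (du + dv) by rewrite -mab -muv.
by rewrite !dotE (dotC du da) (dotC du db); lra.
Qed.

(** Testing at y = x + d/2 with d = u - M x, where M is the displacement map,
    gives <d, u - M y> <= 0, while M y differs from M x by at most |d|/2. *)
Lemma displacement_saturated : saturated dot (fun x => [set M x]).
Proof.
move=> x u xu; rewrite /=; set d := u - M x.
have := xu (x + 2^-1 *: d) _ erefl.
have := displacement_firmly_nonexpansive (x + 2^-1 *: d) x.
set m := M (x + _) => h1.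
have -> : x - (x + 2^-1 *: d) = - (2^-1 *: d).
  by rewrite opprD addrA subrr add0r.
have -> : u - m = d - (m - M x) 
  by apply: (vec_eq hdot) => z; rewrite /d !dotE; ring.
have xd : x + 2^-1 *: d - x = 2^-1 *: d by rewrite addrAC subrr add0r.
move: h1; rewrite xd; move: (m - M x) => e h1 h2.
apply/eqP; rewrite -subr_eq0; apply/eqP; rewrite -/d.
apply: (dot_eq0 hdot); clearbody d.
have := dot_ge0 (e - 2^-1 *: d); move: h1 h2; rewrite !dotE (dotC e d); lra.
Qed.

(** Minty's theorem for the displacement map, which is maximally monotone. *)
Lemma regularized_displacement (e : R) w : 0 < e -> exists x, e *: x + M x = w.
Proof.
move=> e0; have eN0 : e != 0 by rewrite gt_eqF.
have Mmon : monotone_op dot (fun x => [set M x]).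
  move=> x y _ _ -> ->; apply: le_trans (displacement_firmly_nonexpansive x y).
  exact: dot_ge0.
have [x /= Mx] := minty hfin hdot (e^-1 *: w) Mmon displacement_saturated
  (l := e^-1) (eq_ind_r is_true e0 (invr_gt0 e)).
exists x; rewrite -Mx invrK scalerBr scalerA mulfV// scale1r.
by rewrite addrC subrK.
Qed.

(** For the solution x of e x + M x = w, the vectors a - a1 and b - b1 differ by
    e x, and u - u1 and v - v1 add up to - e x, so that the sum of the two
    products is e <x, c - x> - |e x|^2, with c = a1 + u1. Being at least
    - (K + L), it gives |e x|^2 <= e (2 (K + L) + |c|^2) for e <= 1. *)
Lemma closure_displacement_of_bounds w a1 b1 u1 v1 (K L : R) :
    w = a1 - b1 -> w = u1 + v1 ->
    (forall a u, A a u -> - K <= dot (a - a1) (u - u1)) ->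
    (forall b v, B b v -> - L <= dot (b - b1) (v - v1)) ->
  closure (displacement_range A B) w.
Proof.
move=> wab wuv AK BL; apply/closureP => d d0.
pose c := a1 + u1.
have d20 : 0 < d ^+ 2 by rewrite exprn_gt0.
have [e0 e00 e0d] := exists_small_scale (normr_ge0 (2 * (K + L) + dot c c)) d20.
pose e := Num.min e0 1.
have e_gt0 : 0 < e by rewrite lt_min e00 ltr01.
have e_le1 : e <= 1 by rewrite ge_min lexx orbT.
have ed : e * (2 * (K + L) + dot c c) < d ^+ 2.
  apply: le_lt_trans e0d; apply: (@le_trans _ _ (e * `|2 * (K + L) + dot c c|)).
    by rewrite ler_wpM2l ?(ltW e_gt0)// ler_norm.
  by rewrite ler_wpM2r// ge_min lexx.
have [x xw] := regularized_displacement w e_gt0.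
exists (M x); first by exists x.
have -> : M x - w = - (e *: x) by rewrite -xw opprD addrCA subrr addr0.
rewrite normrN.
suff : `|e *: x| ^+ 2 < d ^+ 2.
  by rewrite ltr_pXn2r ?nnegrE ?normr_ge0 ?ltW.
rewrite hdot dotZl dotZr.
have [a [b [u [v [Aau Bbv xau Mx abuv]]]]] := displacement_mem x.
rewrite -/(M x) in Mx.
have := AK _ _ Aau; have := BL _ _ Bbv.
have bE : b - b1 = (a - a1) + e *: x.
  rewrite -(subKr a b) -Mx -(addrK (e *: x) (M x)) [M x + _]addrC xw wab.
  by apply: (vec_eq hdot) => z; rewrite !dotE; ring.
have vE : v - v1 = - (e *: x) - (u - u1).
  rewrite -(addKr u v) -abuv -Mx -(addrK (e *: x) (M x)) [M x + _]addrC xw wuv.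
  by apply: (vec_eq hdot) => z; rewrite !dotE; ring.
have uE : u - u1 = x - c - (a - a1).
  by rewrite xau /c; apply: (vec_eq hdot) => z; rewrite !dotE; ring.
rewrite bE vE uE; move: (a - a1) => f.
clear bE vE uE; clearbody c.
have := dot_ge0 (x - c).
rewrite !dotE (dotC f x) (dotC f c) (dotC c x).
move: ed; have := dot_ge0 x; have := dot_ge0 c.
move: (dot x x) (dot x c) (dot c c) (dot x f) (dot c f) (dot f f).
move=> xx xc cc xf cf ff cc0 xx0 ed xc0 hB hA.
have h1 : 0 <= e * (K + L - (e * (xx - xc) + e * (e * xx))).
  by rewrite mulr_ge0 ?(ltW e_gt0)//; lra.
have h2 : 0 <= e * e * (xx - 2 * xc + cc).
  by rewrite mulr_ge0 ?mulr_ge0 ?(ltW e_gt0)//; lra.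
have h3 : 0 <= e * (1 - e) * cc.
  by rewrite mulr_ge0// mulr_ge0 ?(ltW e_gt0)// subr_ge0.
have h4 : 0 <= e * e * e * xx by rewrite !mulr_ge0// ltW.
lra.
Qed.

End DouglasRachford.

(** * The theorem *)
Lemma star3_lower_bound (R : realType) (X : normedModType R)
    (dot : {dot X for @idfun R}) (A : X -> set X) (x v : X) :
  star3_monotone dot A -> dom A x -> ran A v ->
  exists K, forall a u, A a u -> - K <= dot (a - x) (u - v).
Proof.
move=> [_ Astar] Ax Av; have := Astar _ _ Ax Av.
set S := [set _ | _ in _]; move=> infS.
have Sge a u : A a u -> (ereal_inf S <= (dot (a - x) (u - v))%:E)%E.
  move=> Aau; apply: ereal_inf_lbound; exists (a, u) => //=.
  by rewrite -(opprB a) -(opprB u) dotNl dotNr opprK.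
move: infS Sge; case: (ereal_inf S) => [r _ rS| _ oS|//].
  by exists (- r) => a u /rS; rewrite opprK lee_fin.
by exists 0 => a u /oS; rewrite leye_eq.
Qed.

Theorem proposition6p1 (R : realType) (X : normedModType R)
    (n : nat) (hfin : Vector.axiom n X)
    (dot : {dot X for @idfun R}) (hdot : forall x : X, `|x| ^+ 2 = dot x x)
    (A B : X -> set X)
    (hA : maximally_monotone dot A) (hB : maximally_monotone dot B) :
  let D := set_sub (dom A) (dom B) in
  let S := set_add (ran A) (ran B) in
  [\/ forall w, (ri D `&` ri S) w ->
        ri (set_add (ran A) (ran B)) `<=` ri (ran (op_add A (op_shift B w))),
      star3_monotone dot A /\ star3_monotone dot B,
      set_add (dom B) (ri D `&` ri S) `<=` dom A /\ star3_monotone dot A |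
      exists C : X -> set X,
        [/\ C = A \/ C = B, dom C = setT & star3_monotone dot C]] ->
  [/\ closure (displacement_range A B) = closure (D `&` S),
      closure (D `&` S) = closure D `&` closure S &
      infimal_displacement A B = projector (closure D `&` closure S) 0].
Proof.
move=> D S hyp.
have Amon := hA.1; have Bmon := hB.1.
have Asat := maximally_monotone_saturated hdot hA.
have Bsat := maximally_monotone_saturated hdot hB.
have rangeP := displacement_rangeP hfin hdot Amon Asat Bmon Bsat.
have rect := closure_displacement_of_bounds hfin hdot Amon Asat Bmon Bsat.
have rangeDS : displacement_range A B `<=` D `&` S.
  move=> w /rangeP[a [b [u [v [Aau Bbv wab wuv]]]]]; split.
    by exists a; [exists u|exists b; [exists v|]].
  by exists u; [exists a|exists v; [exists b|]].
have Dnc : nearly_convex D.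
  rewrite /D set_subE; apply: (nearly_convex_comb hfin).
    exact: (nearly_convex_dom hfin hdot).
  exact: (nearly_convex_dom hfin hdot).
have Snc : nearly_convex S.
  rewrite /S set_addE; apply: (nearly_convex_comb hfin).
    exact: (nearly_convex_ran hfin hdot).
  exact: (nearly_convex_ran hfin hdot).
have subT : set_sub D S = setT.
  rewrite -subTset => z _.
  (* Solve a + u = 0 with u in A a, then b + v = a - u - z with v in B b. *)
  have [a Aa] := minty hfin hdot 0 Amon Asat ltr01.
  have [b Bb] := minty hfin hdot (a - (1^-1 *: (0 - a)) - z) Bmon Bsat ltr01.
  move: Aa Bb; set u := _ *: (0 - a); rewrite invr1 scale1r => Aa.
  set v := _ - z - b => Bb.
  exists (a - b); first by exists a; [exists u|exists b; [exists v|]].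
  exists (u + v); first by exists u; [exists a|exists v; [exists b|]].
  by rewrite /v; apply: (vec_eq hdot) => y; rewrite !dotE; ring.
have D_mem w : D w -> exists a b, [/\ dom A a, dom B b & w = a - b].
  by move=> [a Aa [b Bb <-]]; exists a, b.
have S_mem w : S w ->
    exists a u b v, [/\ A a u, B b v & w = u + v].
  by move=> [u [a _ Aau] [v [b _ Bbv] <-]]; exists a, u, b, v.
have Abound a u (Aau : A a u) a' u' : A a' u' -> - 0 <= dot (a' - a) (u' - u).
  by rewrite oppr0 => Aau'; exact: Amon.
have Bbound b v (Bbv : B b v) b' v' : B b' v' -> - 0 <= dot (b' - b) (v' - v).
  by rewrite oppr0 => Bbv'; exact: Bmon.
have ri_range : ri D `&` ri S `<=` closure (displacement_range A B).
  move=> w [Dw Sw].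
  have [a0 [u [b0 [v [Aau Bbv wuv]]]]] := S_mem _ (ri_sub Sw).
  have Au : ran A u by exists a0.
  have Bv : ran B v by exists b0.
  case: hyp => [sub|[Astar Bstar]|[domBA Astar]|[C [CAB CT Cstar]]].
  - apply: subset_closure; apply/rangeP.
    have [y _ [u' Ayu [v' Byv uvw]]] := ri_sub (sub w (conj Dw Sw) w Sw).
    by exists y, (y - w), u', v'; split => //; rewrite subKr.
  - have [a [b [Aa Bb wab]]] := D_mem _ (ri_sub Dw).
    have [K AK] := star3_lower_bound Astar Aa Au.
    have [L BL] := star3_lower_bound Bstar Bb Bv.
    exact: rect wab wuv AK BL.
  - have Abw : dom A (b0 + w).
      by apply: domBA; exists b0; [exists v|exists w].
    have [K AK] := star3_lower_bound Astar Abw Au.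
    by apply: rect _ wuv AK (Bbound _ _ Bbv); rewrite addrC addKr.
  - case: CAB => CE; move: CT Cstar; rewrite CE => CT Cstar.
    + have Abw : dom A (b0 + w) by rewrite CT.
      have [K AK] := star3_lower_bound Cstar Abw Au.
      by apply: rect _ wuv AK (Bbound _ _ Bbv); rewrite addrC addKr.
    + have Baw : dom B (a0 - w) by rewrite CT.
      have [L BL] := star3_lower_bound Cstar Baw Bv.
      by apply: rect _ wuv (Abound _ _ Aau) BL; rewrite subKr.
have meet : closure D `&` closure S `<=` closure (displacement_range A B).
  move=> w /(closure_ri_meet hfin Dnc Snc subT) /(closure_subset ri_range).
  exact: closed_closure.
have inter : closure (D `&` S) `<=` closure D `&` closure S.
  move=> w DSw; split; apply: closure_subset DSw => y; by case.
have DSE : closure (D `&` S) = closure D `&` closure S.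
  apply/seteqP; split => // w /meet; exact: closure_subset.
have rangeE : closure (displacement_range A B) = closure (D `&` S).
  apply/seteqP; split; first exact: closure_subset.
  by rewrite DSE.
by split => //; rewrite /infimal_displacement rangeE DSE.
Qed.
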